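(* Let $\vdash$ be the consequence relation of the logic $R4^\star$ and let $\mathrm{Fml}$ be the algebra of formulas in the language $\{\to,\vee,\wedge,\neg\}$. For every $\Gamma\cup\{\alpha\}\subseteq\mathrm{Fml}$: $\Gamma\vdash\alpha$ if and only if for every subresiduated lattice $A$ and every homomorphism $h:\mathrm{Fml}\to A$ (where $\neg$ is interpreted in $A$ as $\neg x:=x\to 0$), $h(\Gamma)\subseteq\{1\}$ implies $h(\alpha)=1$.
   Context: The logic $R4^\star$ is the Hilbert-style calculus in the language $\{\to,\vee,\wedge,\neg\}$ with axiom schemes: (Ax1) $\alpha\to\alpha$; (Ax2) $(\alpha\to\beta)\to((\beta\to\delta)\to(\alpha\to\delta))$; (Ax3) $(\alpha\to(\beta\to\delta))\to((\alpha\to\beta)\to(\alpha\to\delta))$; (C1) $(\alpha\wedge\beta)\to\alpha$; (C2) $(\alpha\wedge\beta)\to\beta$; (C3) $(\delta\to\alpha)\to((\delta\to\beta)\to(\delta\to(\alpha\wedge\beta)))$; (D1) $\alpha\to(\alpha\vee\beta)$; (D2) $\beta\to(\alpha\vee\beta)$; (D3) $(\alpha\to\delta)\to((\beta\to\delta)\to((\alpha\vee\beta)\to\delta))$; (N1) $\neg\alpha\to(\alpha\to\beta)$; (N2) $(\alpha\to\neg\alpha)\to\neg\alpha$; (Dist) $(\alpha\wedge(\beta\vee\delta))\to((\alpha\wedge\beta)\vee(\alpha\wedge\delta))$; and rules (MP) from $\alpha$ and $\alpha\to\beta$ infer $\beta$; (T) from $\alpha$ infer $\beta\to\alpha$. $\Gamma\vdash\alpha$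 means there is a finite derivation of $\alpha$ from premises in $\Gamma$ (both rules may be applied to any previously derived formulas, including those depending on premises). A subresiduated lattice is an algebra $(A,\wedge,\vee,\to,0,1)$ of type $(2,2,2,0,0)$ such that $(A,\wedge,\vee,0,1)$ is a bounded distributive lattice and for all $x,y,z\in A$: $x\to x=1$; $x\to y\le z\to(x\to y)$; $x\wedge(x\to y)\le y$; $z\to(x\wedge y)=(z\to x)\wedge(z\to y)$; $(x\vee y)\to z=(x\to z)\wedge(y\to z)$; $(x\to y)\wedge(y\to z)\le x\to z$. *)

(* Defs.v *)
From HB Require Import structures.
From mathcomp Require Import all_boot all_order.
From mathcomp Require Import classical_sets.

Set Implicit Arguments.
Unset Strict Implicit.
Unset Printing Implicit Defensive.

Declare Scope fml_scope.
Delimit Scope fml_scope with F.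

(* [V] is the set of propositional variables, left arbitrary. Negation is a
   primitive connective, and there are no truth constants. *)
Inductive Fml (V : Type) : Type :=
| Var of V
| Imp of Fml V & Fml V
| Or of Fml V & Fml V
| And of Fml V & Fml V
| Neg of Fml V.

Bind Scope fml_scope with Fml.
Infix "⊃" := Imp (at level 55, right associativity) : fml_scope.
Infix "∨" := Or (at level 50, left associativity) : fml_scope.
Infix "∧" := And (at level 45, left associativity) : fml_scope.
Notation "¬ a" := (Neg a) (at level 35, right associativity) : fml_scope.

Inductive R4star_axiom (V : Type) : Fml V -> Prop :=
| Ax1 a : R4star_axiom (a ⊃ a)
| Ax2 a b d : R4star_axiom ((a ⊃ b) ⊃ ((b ⊃ d) ⊃ (a ⊃ d)))
| Ax3 a b d : R4star_axiom ((a ⊃ (b ⊃ d)) ⊃ ((a ⊃ b) ⊃ (a ⊃ d)))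
| AxC1 a b : R4star_axiom ((a ∧ b) ⊃ a)
| AxC2 a b : R4star_axiom ((a ∧ b) ⊃ b)
| AxC3 a b d : R4star_axiom ((d ⊃ a) ⊃ ((d ⊃ b) ⊃ (d ⊃ (a ∧ b))))
| AxD1 a b : R4star_axiom (a ⊃ (a ∨ b))
| AxD2 a b : R4star_axiom (b ⊃ (a ∨ b))
| AxD3 a b d : R4star_axiom ((a ⊃ d) ⊃ ((b ⊃ d) ⊃ ((a ∨ b) ⊃ d)))
| AxN1 a b : R4star_axiom ((¬ a) ⊃ (a ⊃ b))
| AxN2 a : R4star_axiom ((a ⊃ (¬ a)) ⊃ (¬ a))
| AxDist a b d : R4star_axiom ((a ∧ (b ∨ d)) ⊃ ((a ∧ b) ∨ (a ∧ d))).

(* Both rules are global: rule (T) may be applied to formulas that depend on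
   the premises in [Gamma]. *)
Inductive derivable (V : Type) (Gamma : set (Fml V)) : Fml V -> Prop :=
| der_premise a : Gamma a -> derivable Gamma a
| der_axiom a : R4star_axiom a -> derivable Gamma a
| der_MP a b : derivable Gamma a -> derivable Gamma (a ⊃ b) ->
    derivable Gamma b
| der_T a b : derivable Gamma a -> derivable Gamma (b ⊃ a).

Local Open Scope order_scope.

(* A [tbDistrLatticeType] may be trivial: [\bot = \top] is not excluded. *)
HB.mixin Record isSubresiduated (d : Order.disp_t) A
    of Order.TBDistrLattice d A := {
  simp : A -> A -> A;
  simpxx : forall x : A, simp x x = \top;
  simp_le_simp : forall x y z : A, simp x y <= simp z (simp x y);
  simp_modus_ponens : forall x y : A, x `&` simp x y <= y;
  simpIr : forall x y z : A, simp z (x `&` y) = simp z x `&` simp z y;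
  simpUl : forall x y z : A, simp (x `|` y) z = simp x z `&` simp y z;
  simp_trans : forall x y z : A, simp x y `&` simp y z <= simp x z
}.

#[short(type="subresiduatedLatticeType")]
HB.structure Definition SubresiduatedLattice (d : Order.disp_t) :=
  { A of Order.TBDistrLattice d A & isSubresiduated d A }.

Definition sneg (d : Order.disp_t) (A : subresiduatedLatticeType d) (x : A) : A :=
  simp x \bot.

Record fml_hom (V : Type) (d : Order.disp_t) (A : subresiduatedLatticeType d)
    (h : Fml V -> A) : Prop := {
  hom_imp : forall a b : Fml V, h (a ⊃ b)%F = simp (h a) (h b);
  hom_or : forall a b : Fml V, h (a ∨ b)%F = h a `|` h b;
  hom_and : forall a b : Fml V, h (a ∧ b)%F = h a `&` h b;
  hom_neg : forall a : Fml V, h (¬ a)%F = sneg (h a)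
}.

(* Main.v *)
(** Soundness: in a subresiduated lattice [simp x y = \top] iff [x <= y], and
    implications residuate: [simp x y `&` z <= t] iff [simp x y <= simp z t].
    Completeness: since rule (T) is global, the implications derivable from
    [Gamma] preorder the formulas so that the quotient is a subresiduated
    lattice, in which the class of a formula is [\top] exactly when [Gamma]
    derives it. *)

Require Import Defs.
From HB Require Import structures.
From mathcomp Require Import all_boot all_order.
From mathcomp Require Import boolp classical_sets.

Import Order.TTheory.

Local Open Scope classical_set_scope.

(** * Soundness in subresiduated lattices *)

Section Soundness.
Local Open Scope order_scope.
Context {d : Order.disp_t} {A : subresiduatedLatticeType d}.
Implicit Types x y z t : A.

(** If [x <= y] then [x] is [x] meet [y], so distributing [simp x] over this meet puts [simp x x],
    which is [\top], below [simp x y]. *)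
Lemma simp_eqtop x y : simp x y = \top <-> x <= y.
Proof.
split=> [xy1|xy]; first by have := simp_modus_ponens x y; rewrite xy1 meetx1.
have /meet_idPl xyE := xy.
apply/eqP; rewrite -le1x -(simpxx x) -{2}xyE simpIr; exact: leIr.
Qed.

Lemma le_simp2l x y z : y <= z -> simp x y <= simp x z.
Proof. by move=> /meet_idPl yzE; rewrite -yzE simpIr leIr. Qed.

(** With [p] for [simp x y], [simp z p] equals [simp z] of the meet of [p] and [z], because
    [simp z z] is [\top]. The bound [p <= simp z p] is available because [p] is an implication. *)
Lemma simp_residuation x y z t : simp x y `&` z <= t -> simp x y <= simp z t.
Proof.
move=> /(le_simp2l z); rewrite simpIr simpxx meetx1; apply: le_trans.
exact: simp_le_simp.
Qed.

(** Each axiom becomes an inequality by [simp_eqtop]. In [Ax2], [Ax3], [AxC3] and [AxD3] the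
    antecedent is an implication, so residuation applies. *)
Lemma R4star_axiom_sound (V : Type) (h : Fml V -> A) (a : Fml V) :
  fml_hom h -> R4star_axiom a -> h a = \top.
Proof.
move=> [hI hU hA hN] []; move=> *; rewrite ?(hI, hU, hA, hN) /sneg ?simpxx //;
  apply/simp_eqtop.
- by apply: simp_residuation; exact: simp_trans.
- apply: simp_residuation; rewrite -simpIr; apply: le_simp2l.
  by rewrite meetC; exact: simp_modus_ponens.
- exact: leIl.
- exact: leIr.
- by apply: simp_residuation; rewrite simpIr.
- exact: leUl.
- exact: leUr.
- by apply: simp_residuation; rewrite simpUl.
- by apply: le_simp2l; exact: le0x.
(* For [AxN2], the factor [simp x x], equal to [\top], brings [x] under the outer arrow, where it
   meets [simp x \bot] below [\bot]. *)
- set x := h _; have -> : simp x (simp x \bot) = simp x (x `&` simp x \bot).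
    by rewrite simpIr simpxx meet1x.
  by apply: le_simp2l; exact: simp_modus_ponens.
- by rewrite meetUr.
Qed.

Lemma derivable_sound (V : Type) (Gamma : set (Fml V)) (h : Fml V -> A)
    (a : Fml V) :
  fml_hom h -> h @` Gamma `<=` [set \top] -> derivable Gamma a -> h a = \top.
Proof.
move=> hh hG; elim=> {a} [a Ga|a /(R4star_axiom_sound _ _ _ hh)//|a b _ ha _|a b _ ha].
- by apply: hG; exists a.
- by rewrite (hom_imp hh) => /simp_eqtop; rewrite ha le1x => /eqP.
- by rewrite (hom_imp hh) ha; apply/simp_eqtop; exact: lex1.
Qed.

End Soundness.

(** * Derived theorems and rules over the premises [Gamma] *)

Section Derivations.
Set Implicit Arguments.
Unset Strict Implicit.
Local Open Scope fml_scope.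
Context {V : Type} (Gamma : set (Fml V)).
Implicit Types a b c : Fml V.
Local Notation "⊢ a" := (derivable Gamma a%F) (at level 70).

Lemma der_refl a : ⊢ a ⊃ a.
Proof. exact/der_axiom/Ax1. Qed.

Lemma der_trans a b c : ⊢ a ⊃ b -> ⊢ b ⊃ c -> ⊢ a ⊃ c.
Proof.
by move=> ab bc; apply: der_MP bc _; apply: der_MP ab _; exact/der_axiom/Ax2.
Qed.

Lemma der_app a b c : ⊢ a ⊃ (b ⊃ c) -> ⊢ a ⊃ b -> ⊢ a ⊃ c.
Proof.
by move=> abc ab; apply: der_MP ab _; apply: der_MP abc _; exact/der_axiom/Ax3.
Qed.

Lemma der_andl a b : ⊢ a ∧ b ⊃ a.
Proof. exact/der_axiom/AxC1. Qed.

Lemma der_andr a b : ⊢ a ∧ b ⊃ b.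
Proof. exact/der_axiom/AxC2. Qed.

Lemma der_andI a b c : ⊢ c ⊃ a -> ⊢ c ⊃ b -> ⊢ c ⊃ a ∧ b.
Proof.
by move=> ca cb; apply: der_MP cb _; apply: der_MP ca _; exact/der_axiom/AxC3.
Qed.

Lemma der_orl a b : ⊢ a ⊃ a ∨ b.
Proof. exact/der_axiom/AxD1. Qed.

Lemma der_orr a b : ⊢ b ⊃ a ∨ b.
Proof. exact/der_axiom/AxD2. Qed.

Lemma der_orE a b c : ⊢ a ⊃ c -> ⊢ b ⊃ c -> ⊢ a ∨ b ⊃ c.
Proof.
by move=> ac bc; apply: der_MP bc _; apply: der_MP ac _; exact/der_axiom/AxD3.
Qed.

Lemma der_and2 a b a' b' : ⊢ a ⊃ a' -> ⊢ b ⊃ b' -> ⊢ a ∧ b ⊃ a' ∧ b'.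
Proof.
by move=> aa' bb'; apply: der_andI; [apply: der_trans aa'|apply: der_trans bb'];
  [exact: der_andl|exact: der_andr].
Qed.

Lemma der_or2 a b a' b' : ⊢ a ⊃ a' -> ⊢ b ⊃ b' -> ⊢ a ∨ b ⊃ a' ∨ b'.
Proof.
by move=> aa' bb'; apply: der_orE; [apply: (der_trans aa')|apply: (der_trans bb')];
  [exact: der_orl|exact: der_orr].
Qed.

Lemma der_impl a b c : ⊢ a ⊃ b -> ⊢ (b ⊃ c) ⊃ (a ⊃ c).
Proof. by move=> ab; apply: der_MP ab _; exact/der_axiom/Ax2. Qed.

(** Rule (T) puts [a] in front of the premise, and [Ax3] distributes it. *)
Lemma der_impr a b c : ⊢ b ⊃ c -> ⊢ (a ⊃ b) ⊃ (a ⊃ c).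
Proof. by move=> /(der_T a)bc; apply: der_MP bc _; exact/der_axiom/Ax3. Qed.

Lemma der_imp2 a b a' b' : ⊢ a' ⊃ a -> ⊢ b ⊃ b' -> ⊢ (a ⊃ b) ⊃ (a' ⊃ b').
Proof.
by move=> a'a bb'; apply: der_trans (der_impl _ a'a) (der_impr _ bb').
Qed.

(* Weakening under [c] is not an axiom; it comes from [a ⊃ b] implying
   [(b ⊃ b) ⊃ (a ⊃ b)] by prefixing, as [c ⊃ (b ⊃ b)] is derivable by (T). *)
Lemma der_imp_weaken a b c : ⊢ (a ⊃ b) ⊃ (c ⊃ (a ⊃ b)).
Proof.
apply: der_trans (der_impl _ (der_T c (der_refl b))).
exact/der_axiom/Ax2.
Qed.

Lemma der_modus_ponens a b : ⊢ a ∧ (a ⊃ b) ⊃ b.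
Proof. exact: der_app (der_andr _ _) (der_andl _ _). Qed.

(** The axiom is curried: the left projection feeds its first antecedent and [der_app] discharges
    the second with the right projection. The next two lemmas uncurry [AxD3] and [Ax2] likewise. *)
Lemma der_imp_and a b c : ⊢ (c ⊃ a) ∧ (c ⊃ b) ⊃ (c ⊃ a ∧ b).
Proof.
apply: der_app (der_andr _ _); apply: der_trans (der_andl _ _) _.
exact/der_axiom/AxC3.
Qed.

Lemma der_or_imp a b c : ⊢ (a ⊃ c) ∧ (b ⊃ c) ⊃ (a ∨ b ⊃ c).
Proof.
apply: der_app (der_andr _ _); apply: der_trans (der_andl _ _) _.
exact/der_axiom/AxD3.
Qed.

Lemma der_imp_trans a b c : ⊢ (a ⊃ b) ∧ (b ⊃ c) ⊃ (a ⊃ c).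
Proof.
apply: der_app (der_andr _ _); apply: der_trans (der_andl _ _) _.
exact/der_axiom/Ax2.
Qed.

(** A negated theorem serves as falsum: [AxN1] leaves the antecedent [a ⊃ a], which is derivable
    under any hypothesis by (T). *)
Lemma der_absurd a b : ⊢ ¬ (a ⊃ a) ⊃ b.
Proof. exact: der_app (der_axiom Gamma (AxN1 _ _)) (der_T _ (der_refl a)). Qed.

(** Falsum implies [¬ a], so the antecedent yields [a ⊃ ¬ a], and [AxN2] concludes. With [AxN1] this
    identifies [¬ a] with [a] implies falsum. *)
Lemma der_neg a b : ⊢ (a ⊃ ¬ (b ⊃ b)) ⊃ ¬ a.
Proof.
by apply: der_trans (der_impr _ (der_absurd _ _)) _; exact/der_axiom/AxN2.
Qed.

End Derivations.

(** * The Lindenbaum algebra of [Gamma] *)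

Section Lindenbaum.
Set Implicit Arguments.
Unset Strict Implicit.
(* The parameter [e] only provides the formula [e ⊃ e] that represents [\top]:
   there is none when [V] is empty. *)
Context {V : Type} (Gamma : set (Fml V)) (e : Fml V).
Local Open Scope quotient_scope.
Implicit Types a b c : Fml V.

Definition provably_le a b := `[< derivable Gamma (a ⊃ b)%F >].

(** The quotient picks representatives; as [V] is arbitrary, [{classic Fml V}] supplies the choice
    structure. *)
Definition provably_eq (a b : {classic Fml V}) :=
  provably_le a b && provably_le b a.

Lemma provably_le_refl : reflexive provably_le.
Proof. by move=> a; apply/asboolP; exact: der_refl. Qed.

Lemma provably_le_trans : transitive provably_le.
Proof.
by move=> b a c /asboolP ab /asboolP bc; apply/asboolP; exact: der_trans ab bc.
Qed.

Lemma provably_eq_refl : reflexive provably_eq.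
Proof. by move=> a; rewrite /provably_eq provably_le_refl. Qed.

Lemma provably_eq_sym : symmetric provably_eq.
Proof. by move=> a b; rewrite /provably_eq andbC. Qed.

Lemma provably_eq_trans : transitive provably_eq.
Proof.
move=> b a c /andP[ab ba] /andP[bc cb].
by rewrite /provably_eq (provably_le_trans ab bc) (provably_le_trans cb ba).
Qed.

Canonical provably_eq_equiv :=
  EquivRel provably_eq provably_eq_refl provably_eq_sym provably_eq_trans.

Definition lindenbaum := {eq_quot provably_eq}.
HB.instance Definition _ := Choice.on lindenbaum.

Definition lclass a : lindenbaum := \pi_lindenbaum (a : {classic Fml V}).
Definition lrepr (x : lindenbaum) : Fml V := repr x.

Lemma lclassP a b : provably_le a b -> provably_le b a -> lclass a = lclass b.
Proof. by move=> ab ba; apply/eqquotP/andP; split. Qed.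

Lemma lreprK x : lclass (lrepr x) = x.
Proof. exact: reprK. Qed.

(** Order and operations are defined on chosen representatives; this equivalence lets them be
    computed on any formula of the class. *)
Lemma lclassK a :
  derivable Gamma (lrepr (lclass a) ⊃ a)%F /\
  derivable Gamma (a ⊃ lrepr (lclass a))%F.
Proof.
have /eqquotP/andP[/asboolP aa' /asboolP a'a] : lclass (lrepr (lclass a)) = lclass a.
  exact: lreprK.
by [].
Qed.

Definition lle (x y : lindenbaum) := provably_le (lrepr x) (lrepr y).
Definition lmeet x y := lclass (lrepr x ∧ lrepr y)%F.
Definition ljoin x y := lclass (lrepr x ∨ lrepr y)%F.
Definition limp x y := lclass (lrepr x ⊃ lrepr y)%F.
Definition ltop := lclass (e ⊃ e)%F.
Definition lbot := lclass (¬ (e ⊃ e))%F.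

Lemma lleE a b : lle (lclass a) (lclass b) = provably_le a b.
Proof.
have [[a1 a2] [b1 b2]] := (lclassK a, lclassK b).
apply/asboolP/asboolP => ab.
  exact: der_trans a2 (der_trans ab b1).
exact: der_trans a1 (der_trans ab b2).
Qed.

Lemma lmeetE a b : lmeet (lclass a) (lclass b) = lclass (a ∧ b)%F.
Proof.
have [[a1 a2] [b1 b2]] := (lclassK a, lclassK b).
by apply: lclassP; apply/asboolP; apply: der_and2.
Qed.

Lemma ljoinE a b : ljoin (lclass a) (lclass b) = lclass (a ∨ b)%F.
Proof.
have [[a1 a2] [b1 b2]] := (lclassK a, lclassK b).
by apply: lclassP; apply/asboolP; apply: der_or2.
Qed.

Lemma limpE a b : limp (lclass a) (lclass b) = lclass (a ⊃ b)%F.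
Proof.
have [[a1 a2] [b1 b2]] := (lclassK a, lclassK b).
by apply: lclassP; apply/asboolP; apply: der_imp2.
Qed.

Lemma lle_refl : reflexive lle.
Proof. by move=> x; exact: provably_le_refl. Qed.

Lemma lle_anti : antisymmetric lle.
Proof.
by move=> x y /andP[xy yx]; rewrite -(lreprK x) -(lreprK y); exact: lclassP.
Qed.

Lemma lle_trans : transitive lle.
Proof. by move=> x y z; exact: provably_le_trans. Qed.

Fact lindenbaum_display : Order.disp_t. Proof. exact: Order.Disp tt tt. Qed.

HB.instance Definition _ := Order.Le_isPOrder.Build lindenbaum_display lindenbaum
  lle_refl lle_anti lle_trans.

Lemma le_lclass a b :
  (lclass a <= lclass b)%O <-> derivable Gamma (a ⊃ b)%F.
Proof. by rewrite -[(_ <= _)%O]/(lle _ _) lleE; split=> /asboolP. Qed.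

Lemma lmeetP x y z : (x <= lmeet y z)%O = (x <= y)%O && (x <= z)%O.
Proof.
rewrite -(lreprK x) -(lreprK y) -(lreprK z) lmeetE.
apply/idP/andP => [/le_lclass xyz|[/le_lclass xy /le_lclass xz]].
  split; apply/le_lclass; apply: der_trans xyz _; first exact: der_andl.
  exact: der_andr.
by apply/le_lclass; exact: der_andI.
Qed.

Lemma ljoinP x y z : (ljoin x y <= z)%O = (x <= z)%O && (y <= z)%O.
Proof.
rewrite -(lreprK x) -(lreprK y) -(lreprK z) ljoinE.
apply/idP/andP => [/le_lclass xyz|[/le_lclass xz /le_lclass yz]].
  split; apply/le_lclass; apply: der_trans xyz; first exact: der_orl.
  exact: der_orr.
by apply/le_lclass; exact: der_orE.
Qed.

HB.instance Definition _ := Order.POrder_MeetJoin_isLattice.Build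
  lindenbaum_display lindenbaum lmeetP ljoinP.

Lemma lmeetUl : @left_distributive lindenbaum lindenbaum Order.meet Order.join.
Proof.
(* One inequality holds in every lattice; the other, after commuting the meets, is [AxDist]. *)
move=> x y z; apply: le_anti; rewrite leUx !leI2 ?leUl ?leUr //=.
rewrite ![Order.meet _ z]meetC -(lreprK x) -(lreprK y) -(lreprK z).
rewrite -[Order.meet]/lmeet -[Order.join]/ljoin !(lmeetE, ljoinE).
by rewrite andbT; apply/le_lclass; exact/der_axiom/AxDist.
Qed.

HB.instance Definition _ := Order.Lattice_Meet_isDistrLattice.Build
  lindenbaum_display lindenbaum lmeetUl.

Lemma lle0x x : (lbot <= x)%O.
Proof. by rewrite -(lreprK x); apply/le_lclass; exact: der_absurd. Qed.

Lemma llex1 x : (x <= ltop)%O.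
Proof. by rewrite -(lreprK x); apply/le_lclass; exact/der_T/der_refl. Qed.

HB.instance Definition _ := Order.hasBottom.Build lindenbaum_display lindenbaum lle0x.
HB.instance Definition _ := Order.hasTop.Build lindenbaum_display lindenbaum llex1.

(** Being above the class of [e ⊃ e] means that [(e ⊃ e) ⊃ a] is derivable; modus ponens removes the
    antecedent and (T) restores it. *)
Lemma lclass_top a : lclass a = Order.top <-> derivable Gamma a.
Proof.
split=> [aE|da].
  by apply: (der_MP (a := (e ⊃ e)%F)); [exact: der_refl|apply/le_lclass; rewrite aE].
by apply/eqP; rewrite -le1x; apply/le_lclass; exact: der_T.
Qed.

Lemma limpxx x : limp x x = Order.top.
Proof. by rewrite -(lreprK x) limpE; apply/lclass_top; exact: der_refl. Qed.

Lemma limp_le_limp x y z : (limp x y <= limp z (limp x y))%O.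
Proof.
rewrite -(lreprK x) -(lreprK y) -(lreprK z) !limpE.
by apply/le_lclass; exact: der_imp_weaken.
Qed.

Lemma limp_modus_ponens x y : (Order.meet x (limp x y) <= y)%O.
Proof.
rewrite -(lreprK x) -(lreprK y) -[Order.meet]/lmeet !(limpE, lmeetE).
by apply/le_lclass; exact: der_modus_ponens.
Qed.

Lemma limpIr x y z : limp z (Order.meet x y) = Order.meet (limp z x) (limp z y).
Proof.
rewrite -(lreprK x) -(lreprK y) -(lreprK z) -[Order.meet]/lmeet !(limpE, lmeetE).
apply: lclassP; apply/asboolP; last exact: der_imp_and.
by apply: der_andI; apply: der_impr; [exact: der_andl|exact: der_andr].
Qed.

Lemma limpUl x y z : limp (Order.join x y) z = Order.meet (limp x z) (limp y z).
Proof.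
rewrite -(lreprK x) -(lreprK y) -(lreprK z) -[Order.meet]/lmeet -[Order.join]/ljoin.
rewrite !(limpE, lmeetE, ljoinE).
apply: lclassP; apply/asboolP; last exact: der_or_imp.
by apply: der_andI; apply: der_impl; [exact: der_orl|exact: der_orr].
Qed.

Lemma limp_trans x y z : (Order.meet (limp x y) (limp y z) <= limp x z)%O.
Proof.
rewrite -(lreprK x) -(lreprK y) -(lreprK z) -[Order.meet]/lmeet !(limpE, lmeetE).
by apply/le_lclass; exact: der_imp_trans.
Qed.

HB.instance Definition _ := isSubresiduated.Build lindenbaum_display lindenbaum
  limpxx limp_le_limp limp_modus_ponens limpIr limpUl limp_trans.

Lemma lclass_hom : fml_hom (lclass : Fml V -> lindenbaum).
Proof.
split=> [a b|a b|a b|a].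
- by rewrite -[simp]/limp limpE.
- by rewrite -[Order.join]/ljoin ljoinE.
- by rewrite -[Order.meet]/lmeet lmeetE.
- rewrite /sneg -[simp]/limp -[Order.bottom]/lbot limpE.
  by apply: lclassP; apply/asboolP; [exact/der_axiom/AxN1|exact: der_neg].
Qed.

End Lindenbaum.

Theorem corollary5p15 (V : Type) (Gamma : set (Fml V)) (alpha : Fml V) :
  derivable Gamma alpha <->
  (forall (d : Order.disp_t) (A : subresiduatedLatticeType d) (h : Fml V -> A),
     fml_hom h ->
     h @` Gamma `<=` [set Order.top] ->
     h alpha = Order.top).
Proof.
split=> [da d A h hh hG|valid]; first exact: derivable_sound hh hG da.
(* [alpha] itself plays the role of [e], and the valuation sends each formula to its class. *)
apply/(lclass_top Gamma alpha); apply: valid; first exact: lclass_hom.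
by move=> _ [a Ga <-]; apply/lclass_top; exact: der_premise.
Qed.
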